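(* Let $\mathbb{F}$ be any field, $k\ge3$, $t\in\mathbb{F}^{n_1}\otimes\cdots\otimes\mathbb{F}^{n_k}$ and $\theta\in\mathcal{P}([k])$. Then $$\rho^\theta(t)\le\sum_{i=1}^k\theta(i)\log_2n_i-\Bigl(\tfrac{2}{\ln2}\min_i\theta(i)\Bigr)\operatorname{instab}(t)^2.$$
   Context: $H$ is Shannon entropy base 2. For a $k$-tuple $C$ of bases of $\mathbb{F}^{n_1},\dots,\mathbb{F}^{n_k}$ with index sets $I_1,\dots,I_k$ ($|I_i|=n_i$), $\operatorname{supp}_Ct\subseteq I_1\times\cdots\times I_k$ is the set of $a$ such that the coefficient of the basis tensor indexed by $a$ in $t$ is nonzero. Strassen upper support functional: $\rho^\theta(t)=\min_C\max_{P\in\mathcal{P}(\operatorname{supp}_Ct)}\sum_i\theta(i)H(P_i)$ where $P_i$ are the marginals of $P$ ($-\infty$ for $t=0$). Instability: $\operatorname{instab}(t)$ is the supremum over $C$, over weight functions $w_i:I_i\to\mathbb{R}_{\ge0}$ ($i\in[k]$) not identically zero, of $\sup\{\varepsilon\ge0:\forall a\in\operatorname{supp}_Ct,\ \sum_{i=1}^kw_i(a_i)\le\sum_{i=1}^k(\frac1{|I_i|}\sum_{x\in I_i}w_i(x)-\varepsilon\max_xw_i(x))\}$. *)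

(* Defs.v *)
From HB Require Import structures.
From mathcomp Require Import all_boot all_order all_algebra.
From mathcomp Require Import all_classical all_reals all_analysis.

Set Implicit Arguments.
Unset Strict Implicit.
Unset Printing Implicit Defensive.

Import Order.TTheory GRing.Theory Num.Theory.

Local Open Scope classical_set_scope.
Local Open Scope ring_scope.

Definition log2 (R : realType) (x : R) : R := ln x / ln 2.

Definition is_distr (R : realType) (T : finType) (p : T -> R) : Prop :=
  (forall x, 0 <= p x) /\ \sum_(x : T) p x = 1.

(* Distributions on a subset A of T are identified with the distributions on T
   that vanish outside A; in particular there are none when A is empty. *)
Definition distr_on (R : realType) (T : finType) (A : {set T}) (p : T -> R) :
  Prop := is_distr p /\ (forall x, x \notin A -> p x = 0).

Definition entropy (R : realType) (T : finType) (p : T -> R) : R :=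
  - \sum_(x : T) p x * log2 (p x).

Definition multi_index (k : nat) (n : 'I_k -> nat) : finType :=
  {dffun forall i : 'I_k, 'I_(n i)}.

(* The tensor product of the spaces F^(n i), in coordinates with respect to the
   tensors of standard basis vectors. *)
Definition tensor (F : fieldType) (k : nat) (n : 'I_k -> nat) : lmodType F :=
  {ffun multi_index n -> F^o}.

Definition pure_tensor (F : fieldType) (k : nat) (n : 'I_k -> nat)
    (v : forall i : 'I_k, 'rV[F]_(n i)) : tensor F n :=
  [ffun j : multi_index n => \prod_(i < k) v i 0 (j i)].

Definition frames (F : fieldType) (k : nat) (n : 'I_k -> nat) : Type :=
  forall i : 'I_k, (n i).-tuple 'rV[F]_(n i).

Definition is_bases (F : fieldType) (k : nat) (n : 'I_k -> nat)
    (C : frames F n) : Prop :=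
  forall i : 'I_k, basis_of fullv (C i).

Definition basis_tensor (F : fieldType) (k : nat) (n : 'I_k -> nat)
    (C : frames F n) (a : multi_index n) : tensor F n :=
  pure_tensor (fun i => tnth (C i) (a i)).

(* Each standard basis vector is expanded in the corresponding basis; that these
   are the coefficients of t in the basis of the tensors basis_tensor C a is
   tensor_coefE and tensor_coef_uniq below. *)
Definition tensor_coef (F : fieldType) (k : nat) (n : 'I_k -> nat)
    (C : frames F n) (t : tensor F n) (a : multi_index n) : F :=
  \sum_(j : multi_index n)
    t j * \prod_(i < k) coord (C i) (a i) (delta_mx 0 (j i)).

Definition tensor_supp (F : fieldType) (k : nat) (n : 'I_k -> nat)
    (C : frames F n) (t : tensor F n) : {set multi_index n} :=
  [set a | tensor_coef C t a != 0]%SET.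

Definition marginal (R : realType) (k : nat) (n : 'I_k -> nat)
    (P : multi_index n -> R) (i : 'I_k) (x : 'I_(n i)) : R :=
  \sum_(a : multi_index n | a i == x) P a.

(* Extended-real valued: the inner supremum is -oo when the support is empty,
   i.e. exactly when t = 0. *)
Definition upper_support (R : realType) (F : fieldType) (k : nat)
    (n : 'I_k -> nat) (theta : 'I_k -> R) (t : tensor F n) : \bar R :=
  ereal_inf [set ereal_sup
      [set (\sum_(i < k) theta i * entropy (marginal P (i := i)))%:E
        | P in [set P : multi_index n -> R | distr_on (tensor_supp C t) P]]
    | C in [set C : frames F n | is_bases C]].

(* The maximum of a weight function; the default value 0 of the iterated max is
   harmless since weights are nonnegative. *)
Definition max_weight (R : realType) (m : nat) (w : 'I_m -> R) : R :=
  \big[Num.max/0]_(x < m) w x.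

Definition weight_family (R : realType) (k : nat) (n : 'I_k -> nat)
    (w : forall i : 'I_k, 'I_(n i) -> R) : Prop :=
  forall i : 'I_k, (forall x, 0 <= w i x) /\ (exists x, w i x != 0).

Definition instab_at (R : realType) (F : fieldType) (k : nat)
    (n : 'I_k -> nat) (t : tensor F n) (C : frames F n)
    (w : forall i : 'I_k, 'I_(n i) -> R) : \bar R :=
  ereal_sup [set eps%:E | eps in [set eps : R | 0 <= eps /\
    forall a : multi_index n, a \in tensor_supp C t ->
      \sum_(i < k) w i (a i) <=
      \sum_(i < k) ((\sum_(x < n i) w i x) / (n i)%:R
                    - eps * max_weight (w i))]].

Definition instab (R : realType) (F : fieldType) (k : nat)
    (n : 'I_k -> nat) (t : tensor F n) : \bar R :=
  ereal_sup [set e | exists (C : frames F n)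
                            (w : forall i : 'I_k, 'I_(n i) -> R),
    [/\ is_bases C, weight_family w & e = instab_at t C w]].
Arguments instab R {F k n} t.

Lemma prod_sum_multi_index (F : fieldType) (k : nat) (n : 'I_k -> nat)
    (G : forall i : 'I_k, 'I_(n i) -> F) :
  \sum_(a : multi_index n) \prod_(i < k) G i (a i) =
  \prod_(i < k) \sum_(x < n i) G i x.
Proof.
rewrite (reindex (@dffun_of_fprod _ (fun i : 'I_k => 'I_(n i)))); last first.
  exact/onW_bij/dffun_of_fprod_bij.
pose P i : {ffun 'I_(n i) -> F} := [ffun x => G i x].
transitivity (\sum_(a : fprod (fun i : 'I_k => 'I_(n i)))
    \prod_(i in 'I_k) P i (a i)).
  by apply: eq_bigr => a _; apply: eq_bigr => i _; rewrite !ffunE.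
rewrite big_fprod; apply/esym.
transitivity (\prod_(i < k) \sum_(x < n i) P i x).
  by apply: eq_bigr => i _; apply: eq_bigr => x _; rewrite ffunE.
pose T (i : 'I_k) : finType := 'I_(n i).
transitivity (\prod_(i < k) \sum_(j in tagged_with T i) untag 0 (P i) j).
  by apply: eq_bigr => i _; apply: (@big_tag _ _ _ _ T (fun i x => P i x) i).
by rewrite bigA_distr_big_dep.
Qed.

Lemma tensor_coefE (F : fieldType) (k : nat) (n : 'I_k -> nat)
    (C : frames F n) (t : tensor F n) : is_bases C ->
  t = \sum_(a : multi_index n) tensor_coef C t a *: basis_tensor C a.
Proof.
move=> bC; apply/ffunP => l; rewrite sum_ffunE.
transitivity (\sum_(j : multi_index n) t j *
    \prod_(i < k) (delta_mx 0 (j i) : 'rV[F]_(n i)) 0 (l i)); last first.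
  under [RHS]eq_bigr => a _ do rewrite !ffunE /tensor_coef.
  under [RHS]eq_bigr => a _ do rewrite [_ *: _]mulr_suml.
  rewrite exchange_big /=; apply: eq_bigr => j _.
  under [RHS]eq_bigr => a _ do rewrite -mulrA -big_split /=.
  rewrite -mulr_sumr; congr (_ * _).
  rewrite (prod_sum_multi_index (fun i x =>
    coord (C i) x (delta_mx 0 (j i)) * tnth (C i) x 0 (l i))).
  apply: eq_bigr => i _.
  have /(congr1 (fun v : 'rV[F]_(n i) => v 0 (l i))) /= -> :=
    coord_basis (bC i) (memvf (delta_mx 0 (j i))).
  rewrite summxE.
  by apply: eq_bigr => x _; rewrite mxE (tnth_nth 0).
rewrite (bigD1 l) //= [X in _ + X]big1 ?addr0 => [|j neq_jl].
  by rewrite big1 ?mulr1 // => i _; rewrite mxE !eqxx.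
have [i neq_ji] : exists i, j i != l i.
  by apply/existsP; apply: contraNT neq_jl; rewrite negb_exists => /forallP h;
     apply/eqP/ffunP => i; apply/eqP; rewrite -[_ == _]negbK; apply: h.
by rewrite (bigD1 i) //= mxE eqxx eq_sym (negbTE neq_ji) mul0r mulr0.
Qed.

Lemma tensor_coef_uniq (F : fieldType) (k : nat) (n : 'I_k -> nat)
    (C : frames F n) (c : multi_index n -> F) :
  is_bases C -> forall a,
  tensor_coef C (\sum_(b : multi_index n) c b *: basis_tensor C b) a = c a.
Proof.
move=> bC a; rewrite /tensor_coef.
transitivity (\sum_(b : multi_index n) c b *
    \prod_(i < k) coord (C i) (a i) (tnth (C i) (b i))).
  under eq_bigr => j _ do rewrite sum_ffunE mulr_suml.
  rewrite exchange_big /=; apply: eq_bigr => b _.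
  under eq_bigr => j _ do rewrite !ffunE -[_ *: _]/(_ * _) -mulrA -big_split /=.
  rewrite -mulr_sumr; congr (_ * _).
  rewrite (prod_sum_multi_index (fun i x =>
    tnth (C i) (b i) 0 x * coord (C i) (a i) (delta_mx 0 x))).
  apply: eq_bigr => i _.
  rewrite [in RHS](row_sum_delta (tnth (C i) (b i))) linear_sum /=.
  by apply: eq_bigr => x _; rewrite linearZ.
have coordE i b : coord (C i) (a i) (tnth (C i) (b i)) = (b i == a i)%:R.
  by rewrite (tnth_nth 0) coord_free // (basis_free (bC i)).
rewrite (bigD1 a) //= [X in _ + X]big1 ?addr0 => [|b neq_ba].
  by rewrite big1 ?mulr1 // => i _; rewrite coordE eqxx.
have [i neq_bai] : exists i, b i != a i.
  by apply/existsP; apply: contraNT neq_ba; rewrite negb_exists => /forallP h;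
     apply/eqP/ffunP => i; apply/eqP; rewrite -[_ == _]negbK; apply: h.
by rewrite (bigD1 i) //= coordE (negbTE neq_bai) mul0r mulr0.
Qed.

(* Main.v *)
(* Let [P] be a distribution on the support of [t] in some bases and let the
   weights [w] witness an instability of at least [eps] in these bases. Averaging
   the defining inequality over [P] shows that, for some [i], the expectation of
   [w i / max (w i)] under the marginal [P_i] is smaller than under the uniform
   distribution by at least [eps]. Pinsker's inequality then gives
   [log2 (n i) - H(P_i) >= 2 / ln 2 * eps ^+ 2], while the other marginals have
   entropy at most [log2 (n j)]. If some [n i = 0], the upper support functional
   is [-oo]; otherwise constant weights show that the instability, a supremum in
   the extended reals, is nonnegative. *)

Require Import Defs.
From HB Require Import structures.
From mathcomp Require Import all_boot all_order all_algebra.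
From mathcomp Require Import all_classical all_reals all_analysis.
From mathcomp Require Import ring lra.

Import Order.TTheory GRing.Theory Num.Theory.
Import numFieldNormedType.Exports.
Local Open Scope ring_scope.

Set Implicit Arguments.
Unset Strict Implicit.
Unset Printing Implicit Defensive.

(* The difference of the two sides, divided by [u (2 u + 4)] and expanded in
   partial fractions, has derivative [(u - 1) ^+ 3 / (u * (u + 2)) ^+ 2], so it
   is minimal at [u = 1], where it vanishes. *)
Lemma xlnx_ge (R : realType) (u : R) : 0 < u ->
  3 * (u - 1) ^+ 2 <= (2 * u + 4) * (u * ln u - u + 1).
Proof.
move=> u0.
pose h (x : R) : R := ln x + (- (5 / 2) + (1 / 4 * x^-1 + 27 / 4 * (x + 2)^-1)).
pose dh (x : R) : R := (x - 1) ^+ 3 / (x * (x + 2)) ^+ 2.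
have dhE (x : R) : 0 < x -> is_derive x 1 h (dh x).
  move=> x0.
  have x20 : 0 < x + 2 by lra.
  have xn0 : x != 0 by rewrite gt_eqF.
  have x2n0 : x + 2 != 0 by rewrite gt_eqF.
  have dln := is_derive1_ln x0.
  have dV : is_derive x 1 (fun y : R => y^-1) (- x ^- 2 *: (1 : R)).
    exact: (is_deriveV (f := id)).
  have dV2 : is_derive x 1 (fun y : R => (y + 2)^-1) (- (x + 2) ^- 2 *: (1 + 0 : R)).
    exact: (is_deriveV (f := fun y : R => y + 2)).
  apply: is_derive_eq.
  rewrite /dh /GRing.scale /=.
  by field; rewrite xn0 x2n0.
have ch (a b : R) : 0 < a -> {within `[a, b], continuous h}%classic.
  move=> a0; apply: derivable_within_continuous => x; rewrite in_itv /= => /andP[ax _].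
  by have [] := dhE x (lt_le_trans a0 ax).
have h1 : h 1 = 0 by rewrite /h ln1; field.
have h0 : 0 <= h u.
  rewrite -h1 -subr_ge0; have [u1|u1] := leP u 1.
    have [x] : exists2 x, x \in `[u, 1] & h 1 - h u = dh x * (1 - u).
      apply: MVT_segment => //; last exact: ch.
      by move=> x; rewrite in_itv /= => /andP[ux _]; apply/dhE/(lt_trans u0).
    rewrite in_itv /= => /andP[ux x1] e; rewrite -opprB e oppr_ge0.
    rewrite mulr_le0_ge0 ?subr_ge0// /dh mulr_le0_ge0 ?invr_ge0 ?sqr_ge0//.
    by rewrite exprS mulr_le0_ge0 ?sqr_ge0// subr_le0.
  have [x] : exists2 x, x \in `[1, u] & h u - h 1 = dh x * (u - 1).
    apply: MVT_segment; [exact: ltW| |exact: ch].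
    by move=> x; rewrite in_itv /= => /andP[ux _]; apply/dhE/(lt_trans ltr01).
  rewrite in_itv /= => /andP[x1 _] ->.
  rewrite mulr_ge0 ?subr_ge0 ?(ltW u1)// /dh mulr_ge0 ?invr_ge0 ?sqr_ge0//.
  by rewrite exprn_ge0 ?subr_ge0.
rewrite -subr_ge0.
have -> : (2 * u + 4) * (u * ln u - u + 1) - 3 * (u - 1) ^+ 2
    = u * (2 * u + 4) * h u.
  have un0 : u != 0 by rewrite gt_eqF.
  have u2n0 : u + 2 != 0 by apply/lt0r_neq0; lra.
  by rewrite /h; field; rewrite un0 u2n0.
by rewrite !mulr_ge0 ?(ltW u0)//; lra.
Qed.

(** Apply [xlnx_ge] at [u = p / q], then bound [(q - p) ^+ 2] below by expanding
    [((q - p) - s * y * A) ^+ 2 >= 0] and using [y ^+ 2 <= 1]. Since [s] is free, this form can be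
    summed termwise and [s] optimised afterwards, which replaces a Cauchy-Schwarz step. *)
Lemma xlnx_divergence_ge (R : realType) (p q s y : R) :
  0 <= p -> 0 < q -> y ^+ 2 <= 1 ->
  3 * (2 * s * (q - p) * y - s ^+ 2 * (2 * p + 4 * q)) <=
  p * (ln p - ln q) - p + q.
Proof.
move=> p0 q0 y1.
set G := (X in _ <= X); set A := 2 * p + 4 * q.
have A0 : 0 < A by rewrite /A; lra.
have GA : 3 * (q - p) ^+ 2 <= A * G.
  move: p0; rewrite le_eqVlt => /predU1P[p0|p0].
    by rewrite /G /A -p0; nra.
  have := xlnx_ge (divr_gt0 p0 q0); rewrite ln_div//.
  rewrite -(ler_pM2r (exprn_gt0 2 q0)) => e.
  have qn0 : q != 0 by rewrite gt_eqF.
  have <- : 3 * (p / q - 1) ^+ 2 * q ^+ 2 = 3 * (q - p) ^+ 2 by field.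
  by rewrite (le_trans e)// le_eqVlt; apply/orP; left; apply/eqP; rewrite /A /G; field.
rewrite -(ler_pM2l A0); apply: le_trans GA.
have h1 : 0 <= (1 - y ^+ 2) * (s * A) ^+ 2.
  by rewrite mulr_ge0 ?sqr_ge0 ?subr_ge0.
have := sqr_ge0 ((q - p) - s * y * A); nra.
Qed.

(* Pinsker's inequality, with the total variation distance replaced by the
   bias of a test function. *)
Lemma pinsker (R : realType) (T : finType) (p q f : T -> R) :
  is_distr p -> is_distr q -> (forall x, 0 < q x) ->
  (forall x, 0 <= f x <= 1) ->
  2 * (\sum_x (q x - p x) * f x) ^+ 2 <= \sum_x p x * (ln (p x) - ln (q x)).
Proof.
move=> [p0 p1] [_ q1] q0 f01; set d := \sum_x _.
(* The values [y = 2 * f x - 1] lie in [-1, 1]. As [q - p] sums to 0, the left side for a general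
   [s] is [3 * (4 * s * d - 6 * s ^+ 2)]; its maximum, at [s = d / 3], is [2 * d ^+ 2]. *)
have : \sum_x 3 * (2 * (d / 3) * (q x - p x) * (2 * f x - 1)
            - (d / 3) ^+ 2 * (2 * p x + 4 * q x)) <=
      \sum_x (p x * (ln (p x) - ln (q x)) - p x + q x).
  apply: ler_sum => x _; apply: xlnx_divergence_ge => //.
  by have /andP[a b] := f01 x; nra.
rewrite !big_split /= sumrN p1 q1 subrK; apply: le_trans.
rewrite -mulr_sumr big_split /= sumrN -mulr_sumr big_split /= -!mulr_sumr p1 q1.
under eq_bigr => x _.
  rewrite (_ : _ * _ = 4 / 3 * d * ((q x - p x) * f x) - 2 / 3 * d * (q x - p x)).
    over.
  by field.
rewrite big_split /= sumrN -!mulr_sumr -/d big_split /= sumrN p1 q1 le_eqVlt.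
by apply/orP; left; apply/eqP; field.
Qed.

(** The deficit is the relative entropy of [p] with respect to the uniform distribution, so
    [pinsker] applies; passing from [ln] to [log2] produces the factor [1 / ln 2]. *)
Lemma entropy_deficit_ge (R : realType) (m : nat) (p f : 'I_m -> R) :
  is_distr p -> (forall x, 0 <= f x <= 1) ->
  2 / ln 2 * ((\sum_x f x) / m%:R - \sum_x p x * f x) ^+ 2 <=
  log2 m%:R - entropy p.
Proof.
move=> dp f01; have [p0 p1] := dp.
have m0 : 0 < m%:R :> R.
  case: m p f dp f01 p0 p1 => [p f _ _ _|m p f _ _ _ _]; last by rewrite ltr0n.
  by rewrite big_ord0 => /eqP; rewrite eq_sym oner_eq0.
have l2 : 0 < ln 2 :> R by rewrite ln_gt0// ltr1n.
have du : is_distr (fun _ : 'I_m => m%:R^-1 : R).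
  split=> [x|]; first by rewrite invr_ge0 ltW.
  by rewrite sumr_const card_ord -[LHS]mulr_natr mulVf// gt_eqF.
have um0 (x : 'I_m) : 0 < m%:R^-1 :> R by rewrite invr_gt0.
have := pinsker dp du um0 f01.
have -> : \sum_x (m%:R^-1 - p x) * f x = (\sum_x f x) / m%:R - \sum_x p x * f x.
  by rewrite mulr_suml -sumrB; apply: eq_bigr => x _; rewrite mulrBl mulrC.
have -> : \sum_x p x * (ln (p x) - ln m%:R^-1) =
    (log2 m%:R - entropy p) * ln 2.
  rewrite /entropy /log2 opprK mulrDl divfK ?gt_eqF// mulr_suml.
  have -> : ln m%:R = \sum_x p x * ln m%:R by rewrite -mulr_suml p1 mul1r.
  rewrite -big_split; apply: eq_bigr => x _ /=.
  by rewrite lnV// -mulrA divfK ?gt_eqF// opprK mulrDr addrC.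
by rewrite -ler_pdivrMr// mulrAC.
Qed.

Lemma sum_marginal (R : realType) (k : nat) (n : 'I_k -> nat)
    (P : multi_index n -> R) (i : 'I_k) (g : 'I_(n i) -> R) :
  \sum_x marginal P x * g x = \sum_a P a * g (a i).
Proof.
rewrite (partition_big (fun a : multi_index n => a i) predT)//=.
apply: eq_bigr => x _; rewrite /marginal mulr_suml.
by apply: eq_bigr => a /eqP ->.
Qed.

Lemma is_distr_marginal (R : realType) (k : nat) (n : 'I_k -> nat)
    (P : multi_index n -> R) (i : 'I_k) :
  is_distr P -> is_distr (marginal P (i := i)).
Proof.
move=> [P0 P1]; split=> [x|]; first exact: sumr_ge0.
have := @sum_marginal _ _ _ P i (fun=> 1).
by under eq_bigr do rewrite mulr1; under [in RHS]eq_bigr do rewrite mulr1; rewrite P1.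
Qed.

Lemma max_weight_gt0 (R : realType) (m : nat) (w : 'I_m -> R) :
  (forall x, 0 <= w x) -> (exists x, w x != 0) -> 0 < max_weight w.
Proof.
move=> w0 [x wx]; apply: (@lt_le_trans _ _ (w x)); last exact: le_bigmax.
by rewrite lt_def wx w0.
Qed.

(* Averaging the instability inequality over [P] shows that some normalised
   weight has bias at least [eps] under the corresponding marginal. *)
Lemma exists_biased_marginal (R : realType) (k : nat) (n : 'I_k -> nat)
    (A : {set multi_index n}) (P : multi_index n -> R)
    (w : forall i : 'I_k, 'I_(n i) -> R) (eps : R) :
  (0 < k)%N -> distr_on A P -> weight_family w ->
  (forall a, a \in A -> \sum_(i < k) w i (a i) <=
     \sum_(i < k) ((\sum_(x < n i) w i x) / (n i)%:R - eps * max_weight (w i))) ->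
  exists i : 'I_k, eps <=
    (\sum_(x < n i) w i x / max_weight (w i)) / (n i)%:R
    - \sum_x marginal P x * (w i x / max_weight (w i)).
Proof.
move=> k0 [[P0 P1] PA] hw hA.
have M0 i : 0 < max_weight (w i) by apply: max_weight_gt0; case: (hw i).
set B := \sum_(i < k) _ in hA.
have avg : \sum_a P a * \sum_(i < k) w i (a i) <= B.
  rewrite -[leRHS]mul1r -P1 mulr_suml; apply: ler_sum => a _.
  have [aA|aA] := boolP (a \in A); last by rewrite PA// !mul0r.
  by rewrite ler_wpM2l// hA.
apply: contrapT => /forallNP no.
suff : B < \sum_a P a * \sum_(i < k) w i (a i) by rewrite ltNge avg.
under [ltRHS]eq_bigr do rewrite mulr_sumr.
rewrite exchange_big /=.
(* Summing strict inequalities stays strict only over a nonempty index set, hence [k0]. *)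
apply: ltr_sum => [|i _].
  by apply/hasP; exists (Ordinal k0); rewrite // mem_index_enum.
rewrite -sum_marginal ltrBlDr -ltrBlDl.
have /negP := no i; rewrite -ltNge -(ltr_pM2r (M0 i)); apply: le_lt_trans.
have Mn0 : max_weight (w i) != 0 by rewrite gt_eqF.
rewrite mulrBl !mulr_suml le_eqVlt; apply/orP; left; apply/eqP.
by congr (_ - _); apply: eq_bigr => x _;
   rewrite ?mulrA ?[_ * _ / _ * _]mulrAC ?divfK// mulrAC divfK.
Qed.

Lemma support_entropy_le (R : realType) (k : nat) (n : 'I_k -> nat)
    (theta : 'I_k -> R) (A : {set multi_index n}) (P : multi_index n -> R)
    (w : forall i : 'I_k, 'I_(n i) -> R) (eps : R) :
  is_distr theta -> distr_on A P -> weight_family w -> 0 <= eps ->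
  (forall a, a \in A -> \sum_(i < k) w i (a i) <=
     \sum_(i < k) ((\sum_(x < n i) w i x) / (n i)%:R - eps * max_weight (w i))) ->
  \sum_(i < k) theta i * entropy (marginal P (i := i)) <=
  \sum_(i < k) theta i * log2 (n i)%:R
  - 2 / ln 2 * inf (range theta) * eps ^+ 2.
Proof.
move=> [th0 th1] dP hw eps0 hA.
have dm i : is_distr (marginal P (i := i)) by apply: is_distr_marginal; case: dP.
have c0 : 0 <= 2 / ln 2 :> R by rewrite divr_ge0// ln_ge0// ler1n.
have k0 : (0 < k)%N.
  case: k n theta A P w {th0 dP hw hA dm} th1 => // n theta A P w.
  by rewrite big_ord0 => /eqP; rewrite eq_sym oner_eq0.
have [i hi] := exists_biased_marginal k0 dP hw hA.
(* The zero test function turns the deficit bound into [entropy <= log2]. *)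
have gap0 j : 0 <= theta j * (log2 (n j)%:R - entropy (marginal P (i := j))).
  apply: mulr_ge0 => //; apply: le_trans (entropy_deficit_ge (f := fun=> 0) (dm j) _).
    by rewrite mulr_ge0 ?sqr_ge0.
  by move=> x; rewrite lexx ler01.
rewrite lerBrDr addrC -lerBrDr -sumrB.
under eq_bigr do rewrite -mulrBr.
rewrite (bigD1 i)//= ler_wpDr ?sumr_ge0//.
rewrite [_ * inf _]mulrC -mulrA; apply: ler_pM; rewrite ?(mulr_ge0 c0) ?sqr_ge0//.
- by apply: lb_le_inf => [|_ [j _ <-]//]; exists (theta i); exists i.
- have lb : has_lbound (range theta) by exists 0 => _ [j _ <-].
  by apply: (ge_inf lb); exists i.
have [w0 wn0] := hw i; have M0 := max_weight_gt0 w0 wn0.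
apply: le_trans (entropy_deficit_ge (f := fun x => w i x / max_weight (w i)) (dm i) _).
  rewrite ler_wpM2l// ler_pXn2r ?nnegrE//.
  exact: le_trans hi.
by move=> x; rewrite divr_ge0 ?(ltW M0)//= ler_pdivrMr// mul1r le_bigmax.
Qed.

Lemma exists_bases (F : fieldType) (k : nat) (n : 'I_k -> nat) :
  exists C : frames F n, is_bases C.
Proof.
have e i : \dim {: 'rV[F]_(n i)} = n i by rewrite dimvf /dim /= mul1n.
exists (fun i => tcast (e i) (vbasis fullv)) => i.
by rewrite val_tcast vbasisP.
Qed.

Lemma upper_support_le (R : realType) (F : fieldType) (k : nat)
    (n : 'I_k -> nat) (theta : 'I_k -> R) (t : tensor F n) (C : frames F n)
    (w : forall i : 'I_k, 'I_(n i) -> R) (eps : R) :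
  is_distr theta -> is_bases C -> weight_family w -> 0 <= eps ->
  (forall a, a \in tensor_supp C t -> \sum_(i < k) w i (a i) <=
     \sum_(i < k) ((\sum_(x < n i) w i x) / (n i)%:R - eps * max_weight (w i))) ->
  (upper_support theta t <=
    (\sum_(i < k) theta i * log2 (n i)%:R
     - 2 / ln 2 * inf (range theta) * eps ^+ 2)%:E)%E.
Proof.
move=> dtheta bC hw eps0 hA; apply: ge_ereal_inf; eexists; first by exists C.
by apply: ge_ereal_sup => _ [P dP <-]; rewrite lee_fin; apply: support_entropy_le dP hw _ _.
Qed.

(** Without multi-indices no distribution has total mass 1, so the inner supremum ranges over the
    empty set. *)
Lemma upper_support_eqNy (R : realType) (F : fieldType) (k : nat)
    (n : 'I_k -> nat) (theta : 'I_k -> R) (t : tensor F n) (i : 'I_k) :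
  n i = 0%N -> upper_support theta t = -oo%E.
Proof.
move=> ni0; have [C bC] := exists_bases F n.
apply/eqP; rewrite -leeNy_eq; apply: ge_ereal_inf; eexists; first by exists C.
apply: ge_ereal_sup => _ [P [[_ P1] _] <-].
have noidx (a : multi_index n) : False.
  by have := leq_ltn_trans (leq0n _) (ltn_ord (a i)); rewrite [X in (_ < X)%N]ni0.
by move: P1; rewrite big1 => [/eqP|a]; [rewrite eq_sym oner_eq0|case: (noidx a)].
Qed.

Lemma weight_family1 (R : realType) (k : nat) (n : 'I_k -> nat) :
  (forall i, (0 < n i)%N) ->
  weight_family (fun (i : 'I_k) (_ : 'I_(n i)) => 1 : R).
Proof.
by move=> n0 i; split=> [x|]; [exact: ler01|exists (Ordinal (n0 i)); exact: oner_neq0].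
Qed.

(** With [eps = 0] this gives both [0 <= instab R t] and the plain entropy bound on
    [upper_support]. *)
Lemma uniform_weight_feasible (R : realType) (k : nat) (n : 'I_k -> nat) :
  (forall i, (0 < n i)%N) ->
  \sum_(i < k) (1 : R) <= \sum_(i < k) ((\sum_(x < n i) 1) / (n i)%:R
    - 0 * max_weight (fun _ : 'I_(n i) => 1 : R)).
Proof.
move=> n0; apply: ler_sum => i _.
by rewrite mul0r subr0 sumr_const card_ord divff// pnatr_eq0 -lt0n.
Qed.

Lemma instab_ge0 (R : realType) (F : fieldType) (k : nat) (n : 'I_k -> nat)
    (t : tensor F n) : (forall i, (0 < n i)%N) -> (0 <= instab R t)%E.
Proof.
move=> n0; have [C bC] := exists_bases F n.
apply: (@le_trans _ _ (instab_at t C (fun i (_ : 'I_(n i)) => 1 : R))).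
  apply: ereal_sup_ubound; exists 0 => //; split => // a _.
  exact: uniform_weight_feasible.
apply: ereal_sup_ubound; exists C, (fun i (_ : 'I_(n i)) => 1).
by split => //; exact: weight_family1.
Qed.

Theorem theorem4p35 (R : realType) (F : fieldType) (k : nat)
    (hk : (3 <= k)%N) (n : 'I_k -> nat) (t : tensor F n)
    (theta : 'I_k -> R) (htheta : is_distr theta) :
  (upper_support theta t <=
     (\sum_(i < k) theta i * log2 (n i)%:R)%:E
     - ((2 / ln 2) * inf (range theta))%:E * instab R t ^+ 2)%E.
Proof.
have [[i ni0]|/forallNP n_neq0] := pselect (exists i, n i = 0%N).
  by rewrite (upper_support_eqNy theta t ni0) leNye.
have n0 i : (0 < n i)%N by rewrite lt0n; apply/eqP.
have [C0 bC0] := exists_bases F n.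
have := upper_support_le (t := t) htheta bC0 (weight_family1 R n0) (lexx 0)
  (fun a _ => uniform_weight_feasible R n0).
rewrite expr0n mulr0 subr0.
set S := \sum_(i < k) _; set c := 2 / ln 2 * _ => leS.
have c0 : 0 <= c.
  rewrite mulr_ge0 ?divr_ge0 ?ln_ge0 ?ler1n//.
  have [th0 _] := htheta; apply: lb_le_inf => [|_ [j _ <-]//].
  by exists (theta (Ordinal hk)); exists (Ordinal hk).
(* For [c = 0] the product with the instability vanishes even if the latter is infinite; otherwise
   division by [c] is possible. *)
have [c00|cn0] := eqVneq c 0; first by rewrite c00 mul0e sube0.
have {cn0}c0 : 0 < c by rewrite lt_def cn0.
case E : (upper_support theta t) leS => [u| |]//; last by move=> _; exact: leNye.
rewrite lee_fin => uS.
(* Solving the bound for [eps] makes it uniform over all bases, weights and feasible [eps]. It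
   therefore passes to the supremum and shows it to be finite. *)
have : (instab R t <= (Num.sqrt ((S - u) / c))%:E)%E.
  apply: ge_ereal_sup => _ [C [w [bC hw ->]]].
  apply: ge_ereal_sup => _ [eps [eps0 heps] <-].
  have := upper_support_le htheta bC hw eps0 heps.
  rewrite E !lee_fin -/S -/c => h.
  rewrite -(ger0_norm eps0) -sqrtr_sqr ler_wsqrtr// ler_pdivlMr//.
  by rewrite mulrC lerBrDr addrC -lerBrDr.
have := instab_ge0 R t n0.
case: (instab R t) => [e| |]//; rewrite lee_fin => e0; rewrite lee_fin => e_le.
rewrite -EFin_expe -EFinM -EFinB lee_fin lerBrDr addrC -lerBrDr.
have : e ^+ 2 <= Num.sqrt ((S - u) / c) ^+ 2 by rewrite ler_pXn2r ?nnegrE ?sqrtr_ge0.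
by rewrite sqr_sqrtr ?divr_ge0 ?subr_ge0 ?(ltW c0)// ler_pdivlMr// mulrC.
Qed.
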